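(* Let $h\in\mathbb{R}[x]$ be a quadratic DTCBF (the DTCBF $h^{(k-1)}$ obtained at iteration $k-1$, $k\in\mathbb{N}$) for the system $x^+=f(x)+g(x)u$ with control admissible set $\mathbb{U}=\{u\in\mathbb{R}^m\mid Mu+d\geqslant 0\}$, with zero-superlevel set $\mathcal{C}=\{x\in\mathbb{R}^n\mid h(x)\geqslant 0\}$, and let $a_{i,j},b_i,c\in\mathbb{R}[x]$ be the polynomials associated with $h$ as in the context. Assume there exist $\gamma(r)=\gamma_0 r$ with $\gamma_0\in(0,1]$, polynomials $\pi_p,\widetilde{\pi}_{p,q}\in\mathbb{R}[x]$ ($1\leqslant p\leqslant m$, $p\leqslant q\leqslant m$), $\Lambda\in\mathrm{SOS}[x]$ and $\Psi\in\mathrm{SOS}[x]^{n_U}$ such that, with $\pi=[\pi_1~\cdots~\pi_m]^{\top}$ and $$\widetilde{h}_+(x)=\sum_{i=1}^m\sum_{j=i}^m a_{i,j}(x)\widetilde{\pi}_{i,j}(x)+\sum_{i=1}^m b_i(x)\pi_i(x)+c(x),$$ one has $$M\pi(x)+d-\Psi(x)h(x)\in\mathrm{SOS}[x]^{n_U},$$ $$\widetilde{h}_+(x)-h(x)+\gamma(h(x))-\Lambda(x)h(x)\in\mathrm{SOS}[x].$$ Assume moreover: (A) for every $p\in\{1,\dots,m\}$ there exist $\sigma_{p,1},\dots,\sigma_{p,4}\in\mathrm{SOS}[x]$ such that $$\begin{bmatrix}1&\pi_p(x)\\ \pi_p(x)&\widetilde{\pi}_{p,p}(x)-\sigma_{p,1}(x)h(x)+\sigma_{p,2}(x)a_{p,p}(x)\end{bmatrix}\succcurlyeq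 0\quad\text{for all }x\in\mathbb{R}^n,$$ $$-\widetilde{\pi}_{p,p}-\sigma_{p,3}h-\sigma_{p,4}a_{p,p}\in\mathrm{SOS}[x];$$ (B) for every $i\in\{1,\dots,m-1\}$ and $j\in\{i+1,\dots,m\}$ there exist $\xi_{i,j,1},\dots,\xi_{i,j,8},\eta_{i,j,1},\dots,\eta_{i,j,8}\in\mathrm{SOS}[x]$ and $\Theta_{i,j,1},\Theta_{i,j,2},\Theta_{i,j,3},\Delta_{i,j,1},\Delta_{i,j,2},\Delta_{i,j,3}\in\mathbb{R}[x]$ such that for all $x\in\mathbb{R}^n$ $$\begin{bmatrix}1&\pi_i\\ \pi_i&\Theta_{i,j,1}-\xi_{i,j,1}h+\xi_{i,j,2}a_{i,j}\end{bmatrix}(x)\succcurlyeq 0,\qquad \begin{bmatrix}1&\pi_j\\ \pi_j&\Theta_{i,j,2}-\xi_{i,j,3}h+\xi_{i,j,4}a_{i,j}\end{bmatrix}(x)\succcurlyeq 0,$$ $$\begin{bmatrix}1&\pi_i\\ \pi_i&\Delta_{i,j,1}-\eta_{i,j,1}h-\eta_{i,j,2}a_{i,j}\end{bmatrix}(x)\succcurlyeq 0,\qquad \begin{bmatrix}1&\pi_j\\ \pi_j&\Delta_{i,j,2}-\eta_{i,j,3}h-\eta_{i,j,4}a_{i,j}\end{bmatrix}(x)\succcurlyeq 0,$$ and the following polynomials belong to $\mathrm{SOS}[x]$: $$\Theta_{i,j,3}-\xi_{i,j,5}h+\xi_{i,j,6}a_{i,j},$$ $$2\widetilde{\pi}_{i,j}-(\Theta_{i,j,1}+\Theta_{i,j,2}+\Theta_{i,j,3})-\xi_{i,j,7}h+\xi_{i,j,8}a_{i,j},$$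 $$-\Delta_{i,j,3}-\eta_{i,j,5}h-\eta_{i,j,6}a_{i,j},$$ $$(\Delta_{i,j,3}-\Delta_{i,j,1}-\Delta_{i,j,2})-2\widetilde{\pi}_{i,j}-\eta_{i,j,7}h-\eta_{i,j,8}a_{i,j}.$$ Then for all $x\in\mathcal{C}$, $$h\bigl(f(x)+g(x)\pi(x)\bigr)-h(x)+\gamma(h(x))\geqslant 0,$$ and $\pi(x)\in\mathbb{U}$ for all $x\in\mathcal{C}$.
   Context: $\mathbb{R}[x]$ denotes real polynomials in $x\in\mathbb{R}^n$; $\mathrm{SOS}[x]\subset\mathbb{R}[x]$ is the set of finite sums of squares of polynomials in $\mathbb{R}[x]$; $\mathrm{SOS}[x]^{r}$ is the set of $r$-vectors of such polynomials. $Q\succcurlyeq 0$ means positive semi-definite. Vector inequalities and products $\Psi(x)h(x)$ are componentwise. System: $x^+=f(x)+g(x)u$ with $x\in\mathbb{R}^n$, $u\in\mathbb{U}\subseteq\mathbb{R}^m$, where $f:\mathbb{R}^n\to\mathbb{R}^n$ and $g:\mathbb{R}^n\to\mathbb{R}^{n\times m}$ have polynomial entries, and $\mathbb{U}=\{u\in\mathbb{R}^m\mid Mu+d\geqslant0\}$ with $M\in\mathbb{R}^{n_U\times m}$, $d\in\mathbb{R}^{n_U}$. $\mathcal{K}_\infty^{\leqslant\mathrm{id}}$ is the set of continuous strictly increasing $\gamma:\mathbb{R}_{\geqslant0}\to\mathbb{R}_{\geqslant0}$ with $\gamma(0)=0$, $\lim_{r\to\infty}\gamma(r)=\infty$, and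 $\gamma(r)\leqslant r$ for all $r$. A function $h:\mathbb{R}^n\to\mathbb{R}$ with zero-superlevel set $\mathcal{C}$ is a discrete-time Control Barrier Function (DTCBF) for the system with $\mathbb{U}$ if there is $\gamma\in\mathcal{K}_\infty^{\leqslant\mathrm{id}}$ such that for each $x\in\mathcal{C}$ there is $u\in\mathbb{U}$ with $h(f(x)+g(x)u)-h(x)\geqslant-\gamma(h(x))$. When $\gamma(r)=\gamma_0r$, $\gamma(h(x))$ means $\gamma_0h(x)$ for every $x\in\mathbb{R}^n$. Quadratic means $h(x)=\vartheta_0+\vartheta_1^{\top}x+x^{\top}\vartheta_2x$ with $\vartheta_0\in\mathbb{R}$, $\vartheta_1\in\mathbb{R}^n$, $\vartheta_2\in\mathbb{R}^{n\times n}$ symmetric. The associated polynomials $a_{i,j},b_i,c\in\mathbb{R}[x]$ ($1\leqslant i\leqslant j\leqslant m$) are the coefficients in the identity $$h(f(x)+g(x)u)=\sum_{i=1}^m\sum_{j=i}^m a_{i,j}(x)u_iu_j+\sum_{i=1}^m b_i(x)u_i+c(x)\quad\text{for all }x\in\mathbb{R}^n,\ u\in\mathbb{R}^m;$$ that is, with $g_i$ the $i$-th column of $g$: $a_{i,i}=g_i^{\top}\vartheta_2g_i$, $a_{i,j}=2g_i^{\top}\vartheta_2g_j$ for $i<j$, $b_i=\vartheta_1^{\top}g_i+2f^{\top}\vartheta_2g_i$, $c=h\circ f$. *)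

(* Defs.v *)
(* The real numbers are an arbitrary R : realType. The file mpoly has to be
   imported before the analysis files, whose notation levels clash with it. *)
From HB Require Import structures.
From mathcomp Require Import all_boot all_order all_algebra.
From mathcomp Require Import mpoly.
From mathcomp Require Import boolp classical_sets set_interval reals.
From mathcomp Require Import topology normedtype.

Set Implicit Arguments.
Unset Strict Implicit.
Unset Printing Implicit Defensive.

Import Order.TTheory GRing.Theory Num.Theory.
Import numFieldNormedType.Exports.

Local Open Scope classical_set_scope.
Local Open Scope ring_scope.

Definition peval (R : realType) (n : nat) (p : {mpoly R[n]}) (x : 'cV[R]_n) : R :=
  p.@[fun i => x i 0].

Definition mxeval (R : realType) (n k l : nat) (A : 'M[{mpoly R[n]}]_(k, l))
    (x : 'cV[R]_n) : 'M[R]_(k, l) :=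
  map_mx (fun p => peval p x) A.

Definition mxconst (R : realType) (n k l : nat) (A : 'M[R]_(k, l)) :
    'M[{mpoly R[n]}]_(k, l) :=
  map_mx (@mpolyC n R) A.

Definition SOS (R : realType) (n : nat) (p : {mpoly R[n]}) : Prop :=
  exists s : seq {mpoly R[n]}, p = \sum_(q <- s) q ^+ 2.

Definition SOSvec (R : realType) (n r : nat) (v : 'cV[{mpoly R[n]}]_r) : Prop :=
  forall k : 'I_r, SOS (v k 0).

Definition psdmx (R : realType) (k : nat) (Q : 'M[R]_k) : Prop :=
  Q^T = Q /\ forall v : 'cV[R]_k, 0 <= (v^T *m Q *m v) 0 0.

Definition mx22 (T : pzRingType) (p q r s : T) : 'M[T]_2 :=
  @block_mx T 1 1 1 1 p%:M q%:M r%:M s%:M.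

Definition step (R : realType) (n m : nat) (f : 'cV[{mpoly R[n]}]_n)
    (g : 'M[{mpoly R[n]}]_(n, m)) (x : 'cV[R]_n) (u : 'cV[R]_m) : 'cV[R]_n :=
  mxeval f x + mxeval g x *m u.

Definition admissible (R : realType) (m nU : nat) (M : 'M[R]_(nU, m))
    (d : 'cV[R]_nU) : set 'cV[R]_m :=
  [set u | forall k : 'I_nU, 0 <= (M *m u + d) k 0].

Definition superlevel (R : realType) (n : nat) (h : 'cV[R]_n -> R) : set 'cV[R]_n :=
  [set x | 0 <= h x].

(* Functions on the half line [0, +oo[ are represented by functions on R whose
   values at negative arguments are ignored; that gamma maps [0, +oo[ into
   itself follows from gamma 0 = 0 and monotonicity. *)
Definition Kinf_le_id (R : realType) (gamma : R -> R) : Prop :=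
  [/\ {within `[0, +oo[, continuous gamma},
      forall r s : R, 0 <= r -> r < s -> gamma r < gamma s,
      gamma 0 = 0,
      gamma r @[r --> +oo] --> +oo
    & forall r : R, 0 <= r -> gamma r <= r].

Definition DTCBF (R : realType) (n m : nat) (f : 'cV[{mpoly R[n]}]_n)
    (g : 'M[{mpoly R[n]}]_(n, m)) (U : set 'cV[R]_m) (h : 'cV[R]_n -> R) : Prop :=
  exists gamma : R -> R, Kinf_le_id gamma /\
    forall x, superlevel h x ->
      exists2 u, U u & h (step f g x u) - h x >= - gamma (h x).

Definition quadratic (R : realType) (n : nat) (h : {mpoly R[n]}) : Prop :=
  exists (th0 : R) (th1 : 'cV[R]_n) (th2 : 'M[R]_n), th2^T = th2 /\
    forall x : 'cV[R]_n,
      peval h x = th0 + (th1^T *m x) 0 0 + (x^T *m th2 *m x) 0 0.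

(* a, b, c are the coefficients of h(f(x) + g(x) u) as a polynomial in u; only
   the entries a i j with i <= j are constrained, and only those are used. *)
Definition associated (R : realType) (n m : nat) (f : 'cV[{mpoly R[n]}]_n)
    (g : 'M[{mpoly R[n]}]_(n, m)) (h : {mpoly R[n]})
    (a : 'I_m -> 'I_m -> {mpoly R[n]}) (b : 'I_m -> {mpoly R[n]})
    (c : {mpoly R[n]}) : Prop :=
  forall (x : 'cV[R]_n) (u : 'cV[R]_m),
    peval h (step f g x u) =
      \sum_(i < m) \sum_(j < m | (i <= j)%N) peval (a i j) x * u i 0 * u j 0
      + \sum_(i < m) peval (b i) x * u i 0 + peval c x.

Definition htilde (R : realType) (n m : nat)
    (a : 'I_m -> 'I_m -> {mpoly R[n]}) (b : 'I_m -> {mpoly R[n]})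
    (c : {mpoly R[n]}) (pi : 'cV[{mpoly R[n]}]_m)
    (pit : 'I_m -> 'I_m -> {mpoly R[n]}) : {mpoly R[n]} :=
  \sum_(i < m) \sum_(j < m | (i <= j)%N) a i j * pit i j
  + \sum_(i < m) b i * pi i 0 + c.

(* Main.v *)
(* On C each product a_ij pit_ij is at most a_ij pi_i pi_j: where a_ij <= 0 the
   certificates force pit_ij >= pi_i pi_j (through pi_i^2 + pi_j^2 >= 2 pi_i pi_j
   when i < j), and where a_ij >= 0 they force pit_ij <= pi_i pi_j. Hence
   htilde <= h (f + g pi) on C, and the certificate for htilde transfers. *)
Require Import Defs.
From HB Require Import structures.
From mathcomp Require Import all_boot all_order all_algebra.
From mathcomp Require Import mpoly.
From mathcomp Require Import boolp classical_sets set_interval reals.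
From mathcomp Require Import topology normedtype.
From mathcomp Require Import lra.

Set Implicit Arguments.
Unset Strict Implicit.
Unset Printing Implicit Defensive.

Import Order.TTheory GRing.Theory Num.Theory.
Import numFieldNormedType.Exports.

Local Open Scope classical_set_scope.
Local Open Scope ring_scope.

Lemma SOS_ge0 (R : realType) (n : nat) (p : {mpoly R[n]}) :
  SOS p -> forall x, 0 <= peval p x.
Proof.
case=> s -> x; rewrite /peval rmorph_sum sumr_ge0 // => q _.
by rewrite rmorphXn /= sqr_ge0.
Qed.

(** Testing the quadratic form on the vector [(- p x, 1)] leaves exactly the Schur complement
    [q x - p x ^+ 2]. *)
Lemma psdmx_mx22_ge (R : realType) (n : nat) (p q : {mpoly R[n]})
    (x : 'cV[R]_n) :
  psdmx (mxeval (mx22 1 p p q) x) -> peval p x ^+ 2 <= peval q x.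
Proof.
(* Size [2] is restated as the convertible [1 + 1], the form in which the block product rules
   apply. *)
pose Q : 'M[R]_(1 + 1) :=
  block_mx (1%:M : 'M_1) (peval p x)%:M (peval p x)%:M (peval q x)%:M.
have QE : mxeval (mx22 1 p p q) x = Q :> 'M_(1 + 1).
  rewrite /mxeval /mx22 (@map_block_mx _ _ _ 1 1 1 1).
  by congr (block_mx _ _ _ _); apply/matrixP => k l;
    rewrite !mxE !ord1 ?mulr1n // /peval rmorph1.
case=> _ psd.
have {psd} : forall v : 'cV_(1 + 1), 0 <= (v^T *m Q *m v) 0 0.
  by rewrite -QE; exact: psd.
move=> /(_ (col_mx (- peval p x)%:M 1%:M)).
rewrite tr_col_mx mul_row_block mul_row_col !(mxE, big_ord1) /= ?mulr1n.
lra.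
Qed.

(** Merges the two sign-dependent certificates into one inequality: [a] will be a value of [a i j],
    [y] of [pit i j], and [z] the product of the inputs. *)
Lemma mulr_le_of_sign (R : realDomainType) (a y z : R) :
  (a <= 0 -> z <= y) -> (0 <= a -> y <= z) -> a * y <= a * z.
Proof.
move=> neg pos; have [a_ge0|/ltW a_le0] := leP 0 a.
  by rewrite ler_wpM2l // pos.
by rewrite ler_wnM2l // neg.
Qed.

Theorem theorem18 (R : realType) (n m nU : nat)
    (f : 'cV[{mpoly R[n]}]_n) (g : 'M[{mpoly R[n]}]_(n, m))
    (M : 'M[R]_(nU, m)) (d : 'cV[R]_nU)
    (h : {mpoly R[n]})
    (h_quadratic : quadratic h)
    (h_DTCBF : DTCBF f g (admissible M d) (peval h))
    (a : 'I_m -> 'I_m -> {mpoly R[n]}) (b : 'I_m -> {mpoly R[n]})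
    (c : {mpoly R[n]})
    (abc_associated : associated f g h a b c)
    (gamma0 : R) (gamma0_gt0 : 0 < gamma0) (gamma0_le1 : gamma0 <= 1)
    (pi : 'cV[{mpoly R[n]}]_m) (pit : 'I_m -> 'I_m -> {mpoly R[n]})
    (Lambda : {mpoly R[n]}) (Lambda_SOS : SOS Lambda)
    (Psi : 'cV[{mpoly R[n]}]_nU) (Psi_SOS : SOSvec Psi)
    (pi_SOS : SOSvec (mxconst n M *m pi + mxconst n d - h *: Psi))
    (htilde_SOS :
      SOS (htilde a b c pi pit - h + gamma0 *: h - Lambda * h))
    (condA : forall p : 'I_m,
      exists sigma1 sigma2 sigma3 sigma4 : {mpoly R[n]},
      [/\ SOS sigma1, SOS sigma2, SOS sigma3 & SOS sigma4] /\
      (forall x : 'cV[R]_n,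
        psdmx (mxeval (mx22 1 (pi p 0)
                            (pi p 0) (pit p p - sigma1 * h + sigma2 * a p p)) x)) /\
      SOS (- pit p p - sigma3 * h - sigma4 * a p p))
    (condB : forall i j : 'I_m, (i < j)%N ->
      exists xi1 xi2 xi3 xi4 xi5 xi6 xi7 xi8 : {mpoly R[n]},
      exists eta1 eta2 eta3 eta4 eta5 eta6 eta7 eta8 : {mpoly R[n]},
      exists Theta1 Theta2 Theta3 Delta1 Delta2 Delta3 : {mpoly R[n]},
      [/\ SOS xi1, SOS xi2, SOS xi3 & SOS xi4] /\
      [/\ SOS xi5, SOS xi6, SOS xi7 & SOS xi8] /\
      [/\ SOS eta1, SOS eta2, SOS eta3 & SOS eta4] /\
      [/\ SOS eta5, SOS eta6, SOS eta7 & SOS eta8] /\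
      (forall x : 'cV[R]_n,
        [/\ psdmx (mxeval (mx22 1 (pi i 0)
                                (pi i 0) (Theta1 - xi1 * h + xi2 * a i j)) x),
            psdmx (mxeval (mx22 1 (pi j 0)
                                (pi j 0) (Theta2 - xi3 * h + xi4 * a i j)) x),
            psdmx (mxeval (mx22 1 (pi i 0)
                                (pi i 0) (Delta1 - eta1 * h - eta2 * a i j)) x)
          & psdmx (mxeval (mx22 1 (pi j 0)
                                (pi j 0) (Delta2 - eta3 * h - eta4 * a i j)) x)]) /\
      [/\ SOS (Theta3 - xi5 * h + xi6 * a i j),
          SOS (2%:R * pit i j - (Theta1 + Theta2 + Theta3) - xi7 * h + xi8 * a i j),
          SOS (- Delta3 - eta5 * h - eta6 * a i j)
        & SOS ((Delta3 - Delta1 - Delta2) - 2%:R * pit i j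
               - eta7 * h - eta8 * a i j)]) :
  (forall x : 'cV[R]_n, superlevel (peval h) x ->
     peval h (step f g x (mxeval pi x)) - peval h x + gamma0 * peval h x >= 0)
  /\
  (forall x : 'cV[R]_n, superlevel (peval h) x -> admissible M d (mxeval pi x)).
Proof.
have pevalD (p q : {mpoly R[n]}) x : peval (p + q) x = peval p x + peval q x.
  exact: mevalD.
have pevalM (p q : {mpoly R[n]}) x : peval (p * q) x = peval p x * peval q x.
  exact: mevalM.
have pevalN (p : {mpoly R[n]}) x : peval (- p) x = - peval p x.
  exact: mevalN.
have pevalE := (pevalD, pevalM, pevalN).
have pevalZ k (p : {mpoly R[n]}) x : peval (k *: p) x = k * peval p x.
  by rewrite /peval mevalZ.
have pevalC k x : peval k%:MP_[n] x = k by rewrite /peval mevalC.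
have peval1 x : peval (1 : {mpoly R[n]}) x = 1 by exact: meval1.
have peval_sum (I : finType) (P : pred I) (F : I -> {mpoly R[n]}) x :
  peval (\sum_(i | P i) F i) x = \sum_(i | P i) peval (F i) x.
  by rewrite /peval rmorph_sum.
split=> x hx; last first.
  move=> k; have := SOS_ge0 (pi_SOS k) x; have := SOS_ge0 (Psi_SOS k) x.
  rewrite !mxE !pevalE peval_sum => psi_ge0.
  have -> : \sum_j peval (mxconst n M k j * pi j 0) x =
            \sum_j M k j * mxeval pi x j 0.
    by apply: eq_bigr => j _; rewrite pevalM !mxE pevalC.
  (* On the superlevel set, [M pi + d >= h Psi >= 0] componentwise. *)
  rewrite pevalC subr_ge0; apply: le_trans.
  exact: mulr_ge0.
(* Signs of products of a multiplier with [h] or [a] are established beforehand, so that [lra] can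
   treat these products as atoms. *)
have h_ge0 q : 0 <= peval q x -> 0 <= peval q x * peval h x.
  by move=> ?; apply: mulr_ge0.
have diag p : peval (a p p) x * peval (pit p p) x <=
              peval (a p p) x * (peval (pi p 0) x * peval (pi p 0) x).
  have [s1 [s2 [s3 [s4]]]] := condA p.
  case=> [[/SOS_ge0/(_ x) S1 /SOS_ge0/(_ x) S2 /SOS_ge0/(_ x) S3 /SOS_ge0/(_ x) S4]].
  case=> /(_ x)/psdmx_mx22_ge + /SOS_ge0/(_ x).
  rewrite !pevalE => lower upper; apply: mulr_le_of_sign => sgn_a.
    by move: (h_ge0 _ S1) (mulr_ge0_le0 S2 sgn_a); lra.
  (* For [a p p >= 0] the certificate even gives [pit p p <= 0], which is at most the square of
     [pi p]. *)
  have := sqr_ge0 (peval (pi p 0) x).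
  by move: (h_ge0 _ S3) (mulr_ge0 S4 sgn_a); lra.
have offdiag (i j : 'I_m) : (i < j)%N -> peval (a i j) x * peval (pit i j) x <=
              peval (a i j) x * (peval (pi i 0) x * peval (pi j 0) x).
  move=> /condB [x1 [x2 [x3 [x4 [x5 [x6 [x7 [x8]]]]]]]].
  case=> [e1 [e2 [e3 [e4 [e5 [e6 [e7 [e8]]]]]]]].
  case=> [T1 [T2 [T3 [D1 [D2 [D3]]]]]].
  case=> [[/SOS_ge0/(_ x) X1 /SOS_ge0/(_ x) X2 /SOS_ge0/(_ x) X3 /SOS_ge0/(_ x) X4]].
  case=> [[/SOS_ge0/(_ x) X5 /SOS_ge0/(_ x) X6 /SOS_ge0/(_ x) X7 /SOS_ge0/(_ x) X8]].
  case=> [[/SOS_ge0/(_ x) E1 /SOS_ge0/(_ x) E2 /SOS_ge0/(_ x) E3 /SOS_ge0/(_ x) E4]].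
  case=> [[/SOS_ge0/(_ x) E5 /SOS_ge0/(_ x) E6 /SOS_ge0/(_ x) E7 /SOS_ge0/(_ x) E8]].
  case=> /(_ x) [/psdmx_mx22_ge + /psdmx_mx22_ge + /psdmx_mx22_ge + /psdmx_mx22_ge +].
  move=> + + + + [/SOS_ge0/(_ x) + /SOS_ge0/(_ x) + /SOS_ge0/(_ x) + /SOS_ge0/(_ x) +].
  (* [pevalE] splits [2%:R] into [1 + 1], hence [peval1]. *)
  rewrite !pevalE !peval1 => Bi Bj Ci Cj B3 B4 C3 C4.
  apply: mulr_le_of_sign => sgn_a.
    (* Here [T1 >= pi_i^2], [T2 >= pi_j^2] and [T3 >= 0], so [2 pit >= T1 + T2 + T3 >= pi_i^2 +
       pi_j^2 >= 2 pi_i pi_j]. *)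
    have := sqr_ge0 (peval (pi i 0) x - peval (pi j 0) x).
    move: (h_ge0 _ X1) (h_ge0 _ X3) (h_ge0 _ X5) (h_ge0 _ X7).
    move: (mulr_ge0_le0 X2 sgn_a) (mulr_ge0_le0 X4 sgn_a).
    by move: (mulr_ge0_le0 X6 sgn_a) (mulr_ge0_le0 X8 sgn_a); lra.
  (* Here [D1 >= pi_i^2], [D2 >= pi_j^2] and [D3 <= 0], so [2 pit <= D3 - D1 - D2 <= - pi_i^2 -
     pi_j^2 <= 2 pi_i pi_j]. *)
  have := sqr_ge0 (peval (pi i 0) x + peval (pi j 0) x).
  move: (h_ge0 _ E1) (h_ge0 _ E3) (h_ge0 _ E5) (h_ge0 _ E7).
  move: (mulr_ge0 E2 sgn_a) (mulr_ge0 E4 sgn_a).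
  by move: (mulr_ge0 E6 sgn_a) (mulr_ge0 E8 sgn_a); lra.
have htilde_le : peval (htilde a b c pi pit) x <= peval h (step f g x (mxeval pi x)).
  (* With [u = mxeval pi x] the linear and constant terms on both sides agree; only the quadratic
     terms remain to be compared, one by one. *)
  rewrite abc_associated /htilde !pevalE !peval_sum !lerD2r.
  apply: lerD; last first.
    by apply: ler_sum => i _; rewrite pevalE mxE.
  apply: ler_sum => i _; rewrite peval_sum; apply: ler_sum => j le_ij.
  rewrite pevalE !mxE -mulrA.
  move: le_ij; rewrite leq_eqVlt => /predU1P[/val_inj <-|]; first exact: diag.
  exact: offdiag.
(* Generalized so that [pevalE] does not unfold [htilde]. *)
move: (htilde _ _ _ _ _) htilde_SOS htilde_le => t /SOS_ge0/(_ x).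
rewrite !pevalE pevalZ.
(* The certificate yields [t - h + gamma0 h >= Lambda h >= 0], and [t] is bounded by the value of
   [h] at the next state. *)
move: (h_ge0 _ (SOS_ge0 Lambda_SOS x)).
lra.
Qed.
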